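(* Let $(P,\eta)$ be a contact manifold of dimension $2n+1$ with Reeb vector field $\mathcal{R}$, let $H:P\to\mathbb{R}$ be smooth, let $M\subseteq P$ be an embedded submanifold, and let $F$ be a vector subbundle of $T_MP$. Let $X$ be a vector field on $P$ such that $$\flat(X)-\mathrm{d}H+(H+\mathcal{R}(H))\,\eta\in F^{\circ}\quad\text{at all points of }M,\qquad X|_{M}\in\mathfrak{X}(M).$$ Let $(q^i,p_i,z)$ be Darboux coordinates ($\eta=\mathrm{d}z-p_i\,\mathrm{d}q^i$), let $\Psi^a=\Phi^a_i\,\mathrm{d}q^i+\Psi^a_i\,\mathrm{d}p_i+\mu^a\,\mathrm{d}z$ be a local basis of sections of $F^{\circ}$, and let $\varphi^b$ be independent local functions on $P$ such that locally $M=\{x:\varphi^b(x)=0\ \forall b\}$. Then, in these coordinates, the integral curves $\xi(t)=(q^i(t),p_i(t),z(t))$ of $X$ in $M$ satisfy, for some functions $\lambda_a$ (Lagrange multipliers), $$\begin{cases}\dfrac{\mathrm{d}q^i}{\mathrm{d}t}=\dfrac{\partial H}{\partial p_i}+\lambda_a\Psi^a_i,\\[2mm] \dfrac{\mathrm{d}p_i}{\mathrm{d}t}=-\dfrac{\partial H}{\partial q^i}-p_i\dfrac{\partial H}{\partial z}-\lambda_a(\mu^ap_i+\Phi^a_i),\\[2mm] \dfrac{\mathrm{d}z}{\mathrm{d}t}=p_i\dfrac{\partial H}{\partial p_i}-H+\lambda_a(\mu^a+p_i\Psi^a_i),\\[2mm] \varphi^b(\xi(t))=0\quad\text{for all }b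.\end{cases}$$
   Context: A contact manifold $(P,\eta)$ of dimension $2n+1$ is a manifold with a $1$-form $\eta$ such that $\eta\wedge(\mathrm{d}\eta)^n$ is a volume form. The map $\flat:TP\to T^*P$, $\flat(v)=\iota_v\mathrm{d}\eta+\eta(v)\eta$, is a vector bundle isomorphism. The Reeb vector field $\mathcal{R}$ is determined by $\iota_{\mathcal{R}}\mathrm{d}\eta=0$, $\eta(\mathcal{R})=1$. $T_MP$ is the restriction of $TP$ to $M$ (tangent vectors to $P$ at points of $M$), and $F^{\circ}\subseteq T^*_MP$ is the annihilator of $F$. Repeated indices are summed. *)

(* Defs.v *)
(* The library has no smooth manifolds; this file sets up the few notions
   needed.  Vectors and covectors are row vectors of components.  A tangent
   (resp. cotangent) vector at a point of a manifold is a family of component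
   rows, one for each chart around the point, subject to the usual
   transformation law; the values of the family at charts whose domain does
   not contain the point are meaningless and are never used. *)
From HB Require Import structures.
From mathcomp Require Import all_boot all_order all_algebra all_fingroup.
From mathcomp Require Import all_classical all_reals all_analysis.
Set Implicit Arguments.
Unset Strict Implicit.
Unset Printing Implicit Defensive.
Import Order.TTheory GRing.Theory Num.Theory.
Import numFieldNormedType.Exports.
Local Open Scope classical_set_scope.
Local Open Scope ring_scope.

Section Coordinates.
Variables (R : realType) (N : nat).
Implicit Types (O : set 'rV[R]_N) (f : 'rV[R]_N -> R) (a : 'rV[R]_N).

(* Intended for open O. *)
Fixpoint Ck (k : nat) O f : Prop :=
  match k with
  | 0 => forall u, O u -> {for u, continuous f}
  | k'.+1 => (forall u, O u -> differentiable f u) /\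
             forall v, Ck k' O (fun u => 'D_v f u)
  end.

Definition Cinfty O f := forall k, Ck k O f.

Definition pairing a (v : 'rV[R]_N) : R := (a *m v^T) 0 0.

Definition kform (k : nat) := ('I_k -> 'rV[R]_N) -> R.

Definition wedge (k l : nat) (al : kform k) (be : kform l) : kform (k + l) :=
  fun v => ((k`! * l`!)%N%:R)^-1 *
    \sum_(s : 'S_(k + l)) (-1) ^+ s *
       al (fun i => v (s (lshift l i))) * be (fun j => v (s (rshift k j))).

Fixpoint wedge_exp (be : kform 2) (n : nat) : kform (n * 2) :=
  match n return kform (n * 2) with
  | 0 => fun _ => 1
  | m.+1 => wedge be (@wedge_exp be m)
  end.

Definition form1 a : kform 1 := fun v => pairing a (v ord0).

Definition form2 (B : 'M[R]_N) : kform 2 :=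
  fun v => (v ord0 *m B *m (v ord_max)^T) 0 0.

End Coordinates.

Arguments wedge_exp {R N} be n v.

Section Manifold.
Variables (R : realType) (N : nat).

(* The maps are total; only cmap on cdom and cinv on cmap @` cdom matter. *)
Record chart (T : topologicalType) := Chart {
  cdom : set T;
  cmap : T -> 'rV[R]_N;
  cinv : 'rV[R]_N -> T;
  cdom_open : open cdom;
  ccod_open : open (cmap @` cdom);
  cmapK : forall x, cdom x -> cinv (cmap x) = x;
  cmap_cont : forall x, cdom x -> {for x, continuous cmap};
  cinv_cont : forall u, (cmap @` cdom) u -> {for u, continuous cinv} }.

Definition smooth_transition (T : topologicalType) (c d : chart T) :=
  forall i : 'I_N, Cinfty (cmap c @` (cdom c `&` cdom d))
                          (fun u => cmap d (cinv c u) 0 i).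

Record manifold := Manifold {
  carrier :> topologicalType;
  manifold_hausdorff : hausdorff_space carrier;
  manifold_second_countable : @second_countable carrier;
  atlas : set (chart carrier);
  atlas_cover : forall x, exists2 c, atlas c & cdom c x;
  atlas_compat : forall c d, atlas c -> atlas d -> smooth_transition c d;
  atlas_maximal : forall c,
    (forall d, atlas d -> smooth_transition c d /\ smooth_transition d c) ->
    atlas c }.

Variable P : manifold.
Implicit Types (c d : chart P) (x y : P) (A U M : set P).

Definition chart_around x c := atlas c /\ cdom c x.

(* A function that matters only on the subset A is smooth on A when it extends
   smoothly to a neighbourhood of each point of A; for open A this is the usual
   smoothness on A. *)
Definition smooth_on A (f : P -> R) := forall x, A x ->
  exists (c : chart P) (O : set 'rV[R]_N) (g : 'rV[R]_N -> R),
    [/\ chart_around x c, open O /\ O (cmap c x), O `<=` cmap c @` cdom c,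
        Cinfty O g &
        forall y, A y -> cdom c y -> O (cmap c y) -> f y = g (cmap c y)].

Record tangent x := Tangent {
  tcomp :> chart P -> 'rV[R]_N;
  tcomp_law : forall c d, chart_around x c -> chart_around x d ->
    tcomp d = 'd (fun u => cmap d (cinv c u)) (cmap c x) (tcomp c) }.

Record cotangent x := Cotangent {
  ccomp :> chart P -> 'rV[R]_N;
  ccomp_law : forall c d, chart_around x c -> chart_around x d ->
    forall v : 'rV[R]_N, pairing (ccomp c) v =
      pairing (ccomp d) ('d (fun u => cmap d (cinv c u)) (cmap c x) v) }.

(* Sections of the restriction of TP to A are total families whose values
   outside A are irrelevant. *)
Definition smooth_vector_field A (X : forall x, tangent x) :=
  forall c, atlas c -> forall i : 'I_N,
    smooth_on (A `&` cdom c) (fun x => X x c 0 i).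

Definition smooth_1form A (al : forall x, cotangent x) :=
  forall c, atlas c -> forall i : 'I_N,
    smooth_on (A `&` cdom c) (fun x => al x c 0 i).

(* The i-th partial derivative of f in the coordinates c. *)
Definition partial c (i : 'I_N) (f : P -> R) x : R :=
  'D_(delta_mx 0 i) (fun u => f (cinv c u)) (cmap c x).

Definition differential c (f : P -> R) x : 'rV[R]_N := \row_i partial c i f x.

(* d al = sum_(i < j) (d_i al_j - d_j al_i) dx^i /\ dx^j, as a skew matrix B
   with (d al)(v, w) = v B w^T. *)
Definition ext_deriv c (al : forall x, cotangent x) x : 'M[R]_N :=
  \matrix_(i, j) (partial c i (fun y => al y c 0 j) x -
                  partial c j (fun y => al y c 0 i) x).

Definition slice_chart (m : nat) M c := atlas c /\
  forall y, cdom c y -> (M y <-> forall i : 'I_N, (m <= i)%N -> cmap c y 0 i = 0).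

Definition embedded_submanifold (m : nat) M := (m <= N)%N /\
  forall x, M x -> exists2 c, slice_chart m M c & cdom c x.

Definition tangent_to (m : nat) M (X : forall x, tangent x) :=
  forall x, M x -> forall c, slice_chart m M c -> cdom c x ->
  forall i : 'I_N, (m <= i)%N -> X x c 0 i = 0.

Definition subbundle M (F : forall x, set (tangent x)) := exists r : nat,
  forall x, M x -> exists (V : set P) (Y : 'I_r -> forall y, tangent y),
  [/\ open V, V x, (forall j, smooth_vector_field (M `&` V) (Y j)) &
      forall y, M y -> V y ->
      (forall a : 'I_r -> R,
         (forall c, chart_around y c -> \sum_j a j *: Y j y c = 0) ->
         forall j, a j = 0) /\
      forall v : tangent y, F y v <->
        exists a : 'I_r -> R,
          forall c, chart_around y c -> v c = \sum_j a j *: Y j y c].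

(* The annihilator of F x, as a set of covector components in the chart c. *)
Definition annihilator (F : forall x, set (tangent x)) x c : set 'rV[R]_N :=
  [set a | forall v, F x v -> pairing a (v c) = 0].

Definition integral_curve (X : forall x, tangent x) (J : set R) (xi : R -> P) :=
  forall t, J t -> {for t, continuous xi} /\
  forall c, chart_around (xi t) c -> forall i : 'I_N,
    is_derive t (1 : R) (fun s => cmap c (xi s) 0 i) (X (xi t) c 0 i).

Definition independent_on A (r : nat) (phi : 'I_r -> P -> R) :=
  forall x, A x -> forall c, chart_around x c ->
  forall a : 'I_r -> R, \sum_b a b *: differential c (phi b) x = 0 ->
  forall b, a b = 0.

(* eta /\ (d eta)^n is a volume form; meant for N = 2n+1. *)
Definition contact_form (n : nat) (eta : forall x, cotangent x) :=
  smooth_1form setT eta /\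
  forall x c, chart_around x c -> exists v : 'I_(1 + n * 2) -> 'rV[R]_N,
    wedge (form1 (eta x c)) (wedge_exp (form2 (ext_deriv c eta x)) n) v != 0.

(* flat(v) = i_v (d eta) + eta(v) eta *)
Definition flat (eta : forall x, cotangent x) c x (v : tangent x) : 'rV[R]_N :=
  v c *m ext_deriv c eta x + pairing (eta x c) (v c) *: eta x c.

Definition Reeb_field (eta : forall x, cotangent x) (Rb : forall x, tangent x) :=
  smooth_vector_field setT Rb /\
  forall x c, chart_around x c ->
    Rb x c *m ext_deriv c eta x = 0 /\ pairing (eta x c) (Rb x c) = 1.

End Manifold.

Section Darboux.
Variables (R : realType) (n : nat).

Definition iq (i : 'I_n) : 'I_(n + n + 1) := lshift 1 (lshift n i).
Definition ip (i : 'I_n) : 'I_(n + n + 1) := lshift 1 (rshift n i).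
Definition iz : 'I_(n + n + 1) := rshift (n + n) ord0.

(* a_i dq^i + b_i dp_i + m dz *)
Definition covec (a b : 'I_n -> R) (m : R) : 'rV[R]_(n + n + 1) :=
  row_mx (row_mx (\row_i a i) (\row_i b i)) (const_mx m).

Variable P : manifold R (n + n + 1).

(* eta = dz - p_i dq^i *)
Definition Darboux_chart (eta : forall x : P, cotangent x) (c : chart R (n + n + 1) P) :=
  atlas c /\ forall x, cdom c x ->
    eta x c = covec (fun i => - cmap c x 0 (ip i)) (fun=> 0) 1.

(* The covector fields Phi^a_i dq^i + Psi^a_i dp_i + mu^a dz form a basis of
   sections over A of the annihilator of F. *)
Definition annihilator_frame (A : set P) (F : forall x : P, set (tangent x))
    (c : chart R (n + n + 1) P) (k : nat)
    (Phi Psi : 'I_k -> 'I_n -> P -> R) (mu : 'I_k -> P -> R) :=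
  let th a x := covec (Phi a ^~ x) (Psi a ^~ x) (mu a x) in
  [/\ forall a i, smooth_on A (Phi a i) /\ smooth_on A (Psi a i),
      forall a, smooth_on A (mu a) &
      forall x, A x ->
      [/\ forall a, annihilator F x c (th a x),
          forall l : 'I_k -> R, \sum_a l a *: th a x = 0 -> forall a, l a = 0 &
          forall w, annihilator F x c w ->
            exists l : 'I_k -> R, w = \sum_a l a *: th a x]].

End Darboux.

(* Main.v *)
Require Import Defs.
From HB Require Import structures.
From mathcomp Require Import all_boot all_order all_algebra all_fingroup.
From mathcomp Require Import all_classical all_reals all_analysis.
From mathcomp Require Import ring.
Set Implicit Arguments.
Unset Strict Implicit.
Unset Printing Implicit Defensive.
Import Order.TTheory GRing.Theory Num.Theory.
Import numFieldNormedType.Exports.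
Local Open Scope classical_set_scope.
Local Open Scope ring_scope.

(** In Darboux coordinates flat(X) = - X^{p_i} dq^i + X^{q^i} dp_i + eta(X) eta
    and the Reeb field is d/dz.  Hence the covector
      w = flat(X) - dH + (H + R(H)) eta
    has explicit components ([hamiltonian_defect_q], [hamiltonian_defect_p],
    [hamiltonian_defect_z]).  On M it lies in the annihilator of F, so that
    w = lambda_a Psi^a.  The dz-component of this identity gives
    eta(X) = - H + lambda_a mu^a, the dp_i-component gives dq^i/dt, the
    dq^i-component gives dp_i/dt once eta(X) is replaced by its value, and
    dz/dt = eta(X) + p_i dq^i/dt.  The equations phi^b(xi(t)) = 0 say that the
    curve stays in M.

    What takes work is that the multipliers are smooth.  Write Theta for the
    matrix with rows Psi^a, so that w = lambda Theta.  Its rows are independent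
    at a given point x0, hence Theta(x0) K = 1 for a constant matrix K, and
    Cramer's rule for w K = lambda (Theta K) reads
      lambda det(Theta K) = w K adj(Theta K)        ([smooth_at_coefs]).
    The determinant is 1 at x0, so near x0 lambda is a quotient of functions
    built from w and Theta by sums and products.

    The input functions are smooth each in a chart of its own choosing.  The
    chain rule for functions of class C^k ([Ck_comp]) moves all of them to the
    Darboux chart ([smooth_on_at]), where [smooth_at], smoothness near one
    point relative to a subset, is closed under the algebraic operations. *)

(** * Functions of class C^k on open sets of R^N *)

(** The increment of [g] at [x] has the same expansion as that of [f], because
    both the values at [x] and the values nearby agree. *)
Lemma near_eq_differentiable (R : numFieldType) (V W : normedModType R)
    (f g : V -> W) (x : V) :
  (\near x, f x = g x) -> differentiable f x -> differentiable g x.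
Proof.
move=> fg df.
have fgx : f x = g x by exact: (nbhs_singleton fg).
pose L := 'd f x.
have Lc : continuous L by exact: diff_continuous.
have gE : g \o shift x = cst (g x) + L +o_ (0 : V) id.
  apply/eqaddoP => e e0.
  have /eqaddoP/(_ e e0) fE := diff_locally df.
  have fg0 : \forall y \near (0 : V), f (y + x) = g (y + x).
    by move: fg; rewrite (near_shift 0) /= subr0.
  near=> y.
  have <- : (f \o shift x - (cst (f x) + L)) y =
      (g \o shift x - (cst (g x) + L)) y.
    by rewrite !fctE fgx; congr (_ - _); rewrite /=; near: y.
  near: y; exact: fE.
have dE : 'd g x = L :> (V -> W) by exact: diff_unique.
by apply/diff_locallyP; rewrite dE.
Unshelve. all: by end_near. Qed.

Section Calculus.
Variables (R : realType) (N : nat).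
Implicit Types (O : set 'rV[R]_N) (f g h : 'rV[R]_N -> R) (k : nat).

Lemma open_near_eq O f g u : open O -> O u -> (forall u, O u -> f u = g u) ->
  \near u, f u = g u.
Proof.
by move=> oO Ou fg; apply: filterS (open_nbhs_nbhs (conj oO Ou)) => w /fg.
Qed.

(** Each closure lemma below computes a directional derivative by a rule valid
    only at the points of [O]; the derivative therefore agrees with a [Ck]
    function on [O] alone, and this lemma transfers the class. *)
Lemma Ck_ext k O f g : open O -> (forall u, O u -> f u = g u) ->
  Ck k O f -> Ck k O g.
Proof.
move=> oO; elim: k f g => [|k IH] f g fg /=.
  move=> cf u Ou; have nfg := open_near_eq oO Ou fg.
  apply: cvg_trans (near_eq_cvg nfg) _.
  by rewrite -(fg u Ou); exact: cf.
move=> [df Cf]; split=> [u Ou|v].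
  by apply: near_eq_differentiable (df u Ou); exact: open_near_eq Ou fg.
by apply: IH (Cf v) => u Ou; apply: near_eq_derive; exact: open_near_eq Ou fg.
Qed.

Lemma CkW k O f : Ck k.+1 O f -> Ck k O f.
Proof.
elim: k f => [|k IH] f; first by move=> [df _] u /df/differentiable_continuous.
by move=> [df Cf]; split=> // v; apply: IH.
Qed.

Lemma Ck_sub k O O' f : O `<=` O' -> Ck k O' f -> Ck k O f.
Proof.
move=> OO'; elim: k f => [|k IH] f; first by move=> cf u /OO'/cf.
by move=> [df Cf]; split=> [u Ou|v]; [exact/df/OO'|exact: IH (Cf v)].
Qed.

Lemma Ck_cst k O (a : R) : Ck k O (fun=> a).
Proof.
elim: k a => [|k IH] a; first by move=> u _; exact: cst_continuous.
split=> [u _|v]; first exact: differentiable_cst.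
by under eq_fun do rewrite derive_cst.
Qed.

Lemma CkD k O f g : open O -> Ck k O f -> Ck k O g ->
  Ck k O (fun u => f u + g u).
Proof.
move=> oO; elim: k f g => [|k IH] f g.
  by move=> cf cg u Ou; exact: continuousD (cf u Ou) (cg u Ou).
move=> [df Cf] [dg Cg]; split=> [u Ou|v].
  by apply: differentiableD; [exact: df|exact: dg].
apply: (Ck_ext oO) (IH _ _ (Cf v) (Cg v)) => u Ou.
by rewrite deriveD //; apply: diff_derivable; [exact: df|exact: dg].
Qed.

Lemma CkM k O f g : open O -> Ck k O f -> Ck k O g ->
  Ck k O (fun u => f u * g u).
Proof.
move=> oO; elim: k f g => [|k IH] f g.
  by move=> cf cg u Ou; exact: continuousM (cf u Ou) (cg u Ou).
move=> Cf1 Cg1; have [Cf0 Cg0] := (CkW Cf1, CkW Cg1).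
case: Cf1 Cg1 => [df Cf] [dg Cg]; split=> [u Ou|v].
  by apply: differentiableM; [exact: df|exact: dg].
apply: (Ck_ext oO) (CkD oO (IH _ _ Cf0 (Cg v)) (IH _ _ Cg0 (Cf v))) => u Ou.
by rewrite deriveM //; apply: diff_derivable; [exact: df|exact: dg].
Qed.

Lemma CkV k O f : open O -> (forall u, O u -> f u != 0) -> Ck k O f ->
  Ck k O (fun u => (f u)^-1).
Proof.
move=> oO f0; elim: k => [|k IH] Cf1.
  by move=> u Ou; exact: continuousV (f0 u Ou) (Cf1 u Ou).
have IV := IH (CkW Cf1); case: Cf1 => [df Cf]; split=> [u Ou|v].
  by apply: differentiableV; [exact: df|exact: f0].
apply: (Ck_ext oO)
  (CkM oO (CkM oO (Ck_cst k O (-1)) (CkM oO IV IV)) (Cf v)) => u Ou.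
(* The derivative is -1 * ((1/f) * (1/f)) * f', with 1/f of class C^k by IH. *)
rewrite deriveV; [|exact: f0|exact/diff_derivable/df].
by rewrite mulN1r -invfM -expr2.
Qed.

(** The coordinate is packed as a linear map, whose differential is itself. *)
Lemma derive_coord (i : 'I_N) (u v : 'rV[R]_N) :
  'D_v (fun w : 'rV[R]_N => w 0 i) u = v 0 i.
Proof.
rewrite deriveE; last exact: differentiable_coord.
have @l : {linear 'rV[R]_N -> R}.
  by exists (fun w : 'rV[R]_N => w 0 i); do 2![eexists]; do ?[constructor];
     rewrite ?mxE // => ? *; rewrite ?mxE //; move=> ?; rewrite !mxE.
have lE : (fun w : 'rV[R]_N => w 0 i) = l by [].
by rewrite lE diff_lin //; exact: coord_continuous.
Qed.

Lemma Ck_coord k O (i : 'I_N) : Ck k O (fun u => u 0 i).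
Proof.
case: k => [|k]; first by move=> u _; exact: coord_continuous.
split=> [u _|v]; first exact: differentiable_coord.
by under eq_fun do rewrite derive_coord; exact: Ck_cst.
Qed.

Lemma differentiable_row N' (t : 'rV[R]_N -> 'rV[R]_N') u :
  (forall i, differentiable (fun w => t w 0 i) u) -> differentiable t u.
Proof.
move=> dt.
have -> : t = \sum_(i < N') (fun w => t w 0 i *: delta_mx 0 i).
  by apply/funext => w; rewrite fct_sumE -row_sum_delta.
by apply: differentiable_sum => i; apply: differentiableZl.
Qed.

Lemma derive_row N' (t : 'rV[R]_N -> 'rV[R]_N') u v :
  (forall i, differentiable (fun w => t w 0 i) u) ->
  'D_v t u = \sum_i 'D_v (fun w => t w 0 i) u *: delta_mx 0 i.
Proof.
move=> dt.
have {1}-> : t = \sum_(i < N') (fun w => t w 0 i *: delta_mx 0 i).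
  by apply/funext => w; rewrite fct_sumE -row_sum_delta.
have dti i : differentiable (fun w => t w 0 i *: (delta_mx 0 i : 'rV[R]_N')) u.
  exact: differentiableZl.
rewrite derive_sum => [|i]; last exact: diff_derivable.
by apply: eq_bigr => i _; rewrite deriveE // diffZl // -deriveE.
Qed.

Lemma derive_chain (t : 'rV[R]_N -> 'rV[R]_N) g u v :
  (forall i, differentiable (fun w => t w 0 i) u) -> differentiable g (t u) ->
  'D_v (g \o t) u =
    \sum_i 'D_v (fun w => t w 0 i) u * 'D_(delta_mx 0 i) g (t u).
Proof.
move=> dt dg; have dtu := differentiable_row dt.
rewrite deriveE; last exact: differentiable_comp.
rewrite diff_comp //= -(deriveE v dtu) derive_row // linear_sum.
by apply: eq_bigr => i _; rewrite linearZ -deriveE.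
Qed.

Lemma Ck_sum k O (I : Type) (s : seq I) (F : I -> 'rV[R]_N -> R) : open O ->
  (forall i, Ck k O (F i)) -> Ck k O (fun u => \sum_(i <- s) F i u).
Proof.
move=> oO CF; elim: s => [|i s IH].
  by under eq_fun do rewrite big_nil; exact: Ck_cst.
by under eq_fun do rewrite big_cons; exact: CkD.
Qed.

Lemma Cinfty_derive O f v : Cinfty O f -> Cinfty O (fun u => 'D_v f u).
Proof. by move=> Cf k; have [_ /(_ v)] := Cf k.+1. Qed.

(** By induction on [k], for all [g] at once: by the chain rule a directional
    derivative of [g \o t] is a sum of products of derivatives of the
    components of [t] with partial derivatives of [g] composed with [t], and
    the latter are covered by the induction hypothesis. *)
Lemma Ck_comp k O O' (t : 'rV[R]_N -> 'rV[R]_N) g : open O ->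
  (forall i, Cinfty O (fun u => t u 0 i)) -> (forall u, O u -> O' (t u)) ->
  Cinfty O' g -> Ck k O (g \o t).
Proof.
move=> oO Ct tO; have dt u i : O u -> differentiable (fun w => t w 0 i) u.
  by move=> Ou; have [dti _] := Ct i 1%N; exact: (dti u Ou).
have dtu u : O u -> differentiable t u.
  by move=> Ou; apply: differentiable_row => i; exact: dt.
elim: k g => [|k IH] g Cg.
  move=> u Ou.
  exact: continuous_comp (differentiable_continuous (dtu u Ou))
    (Cg 0%N _ (tO u Ou)).
have dg u : O u -> differentiable g (t u).
  by move=> /tO Ou; have [dg1 _] := Cg 1%N; exact: (dg1 _ Ou).
split=> [u Ou|v]; first by apply: differentiable_comp; [exact: dtu|exact: dg].
apply: (Ck_ext oO (f := fun u =>
   \sum_i 'D_v (fun w => t w 0 i) u * 'D_(delta_mx 0 i) g (t u))).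
  by move=> u Ou; rewrite derive_chain // => [i|]; [exact: dt|exact: dg].
apply: Ck_sum => // i; apply: CkM => //; first exact: (Cinfty_derive v (Ct i)).
exact: (IH _ (Cinfty_derive (delta_mx 0 i) Cg)).
Qed.

End Calculus.

(** * Smoothness near a point, read in a fixed chart *)

Section SmoothGerms.
Variables (R : realType) (N : nat) (P : manifold R N).
Implicit Types (c d : chart R N P) (x y : P) (A : set P) (f g h : P -> R).

(** The germ at [x] of the condition defining [smooth_on A], with the chart
    prescribed instead of existentially chosen. *)
Definition smooth_at c A x f :=
  exists (O : set 'rV[R]_N) (g : 'rV[R]_N -> R),
  [/\ open O, O (cmap c x), O `<=` cmap c @` cdom c, Cinfty O g &
      forall y, A y -> cdom c y -> O (cmap c y) -> f y = g (cmap c y)].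

(** In the image of the chart, the image of [A] is the preimage of [A] under
    the continuous inverse. *)
Lemma cmap_open c A : open A -> A `<=` cdom c -> open (cmap c @` A).
Proof.
move=> oA Ac.
have -> : cmap c @` A = [set u | (cmap c @` cdom c) u /\ A (cinv c u)].
  apply/seteqP; split=> [_ [x Ax <-]|u [[x cx <-]]] /=.
    by rewrite cmapK; [split=> //; exists x => //|]; exact: Ac.
  by rewrite cmapK // => Ax; exists x.
rewrite openE => u [cu Au]; rewrite /interior.
have oc := @ccod_open _ _ _ c.
have : nbhs u (cinv c @^-1` A) by apply: (cinv_cont cu); exact: open_nbhs_nbhs.
apply: filterS2 (open_nbhs_nbhs (conj oc cu)) => w cw Aw; by split.
Qed.

(** A smooth extension in some chart [d] is carried to [c] by composition with
    the transition map, which is smooth by compatibility of the atlas. *)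
Lemma smooth_on_at c A x f : smooth_on A f -> A x -> chart_around x c ->
  smooth_at c A x f.
Proof.
move=> sf Ax [ac cx].
have [d [ O [g [[ad dx] [oO Ox] _ Cg fg]]]] := sf x Ax.
pose t u := cmap d (cinv c u).
have tE y : cdom c y -> t (cmap c y) = cmap d y by move=> cy; rewrite /t cmapK.
pose D := cdom c `&` cdom d `&` (fun y => O (cmap d y)).
have oD : open D.
  rewrite openE => y [[cy dy] Oy]; rewrite /interior /D.
  have : nbhs y (cmap d @^-1` O).
    by apply: (cmap_cont dy); exact: open_nbhs_nbhs.
  by apply: filterI; apply: open_nbhs_nbhs; split=> //; apply: openI;
    exact: cdom_open.
have Dc : D `<=` cdom c by move=> y [[]].
exists (cmap c @` D), (g \o t); split.
- exact: cmap_open.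
- by exists x.
- by move=> _ [y /Dc cy <-]; exists y.
- move=> k; apply: (Ck_comp _ _ _ _ Cg).
  - exact: cmap_open.
  - move=> i j; apply: Ck_sub (atlas_compat ac ad i j).
    by move=> _ [y [ydom _] <-]; exists y.
  - by move=> _ [y [[cy _] Oy] <-]; rewrite tE.
move=> y Ay cy [z [[cz dz] Oz] zy].
have {}zy : z = y by rewrite -(cmapK cz) zy cmapK.
by rewrite /= tE // -zy fg // zy.
Qed.

Lemma smooth_at_on A f :
  (forall x, A x -> exists2 c, chart_around x c & smooth_at c A x f) ->
  smooth_on A f.
Proof.
by move=> sf x /sf [c xc] [ O [g [oO Ox Oc Cg fg]]]; exists c, O, g; split.
Qed.

Section InChart.
Variables (c : chart R N P) (x : P) (cx : cdom c x).
Implicit Types (I : Type).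

Lemma smooth_at_ext A f g : (forall y, A y -> cdom c y -> f y = g y) ->
  smooth_at c A x f -> smooth_at c A x g.
Proof.
move=> fg [ O [h [oO Ox Oc Ch fh]]]; exists O, h; split=> // y Ay cy Oy.
by rewrite -fg // fh.
Qed.

Lemma smooth_at_sub A A' f : A `<=` A' -> smooth_at c A' x f ->
  smooth_at c A x f.
Proof.
move=> AA' [ O [h [oO Ox Oc Ch fh]]].
by exists O, h; split=> // y /AA'; exact: fh.
Qed.

Lemma smooth_at_cst A (a : R) : smooth_at c A x (fun=> a).
Proof.
exists (cmap c @` cdom c), (fun=> a); split=> //; first exact: ccod_open.
by move=> k; exact: Ck_cst.
Qed.

Lemma smooth_at_cmap A i : smooth_at c A x (fun y => cmap c y 0 i).
Proof.
exists (cmap c @` cdom c), (fun u => u 0 i); split=> //; first exact: ccod_open.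
by move=> k; exact: Ck_coord.
Qed.

Lemma smooth_at_op2 (op : R -> R -> R) A f g :
  (forall O (u v : 'rV[R]_N -> R), open O -> Cinfty O u -> Cinfty O v ->
     Cinfty O (fun w => op (u w) (v w))) ->
  smooth_at c A x f -> smooth_at c A x g ->
  smooth_at c A x (fun y => op (f y) (g y)).
Proof.
move=> Cop [ O [u [oO Ox Oc Cu fu]]] [ O' [v [oO' Ox' Oc' Cv gv]]].
have oI : open (O `&` O') by exact: openI.
exists (O `&` O'), (fun w => op (u w) (v w)); split=> //.
- by move=> w [/Oc].
- by apply: Cop => // k; [apply: Ck_sub (Cu k)|apply: Ck_sub (Cv k)] => w [].
- by move=> y Ay cy [Oy Oy']; rewrite fu // gv.
Qed.

Lemma smooth_atD A f g : smooth_at c A x f -> smooth_at c A x g ->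
  smooth_at c A x (fun y => f y + g y).
Proof. by apply: smooth_at_op2 => O u v oO Cu Cv k; exact: CkD. Qed.

Lemma smooth_atM A f g : smooth_at c A x f -> smooth_at c A x g ->
  smooth_at c A x (fun y => f y * g y).
Proof. by apply: smooth_at_op2 => O u v oO Cu Cv k; exact: CkM. Qed.

Lemma smooth_atN A f : smooth_at c A x f -> smooth_at c A x (fun y => - f y).
Proof.
move=> sf; under eq_fun do rewrite -mulN1r.
exact: smooth_atM (smooth_at_cst _ _) sf.
Qed.

Lemma smooth_atB A f g : smooth_at c A x f -> smooth_at c A x g ->
  smooth_at c A x (fun y => f y - g y).
Proof. by move=> sf /smooth_atN; exact: smooth_atD. Qed.

Lemma smooth_at_sum I (s : seq I) A (F : I -> P -> R) :
  (forall i, smooth_at c A x (F i)) ->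
  smooth_at c A x (fun y => \sum_(i <- s) F i y).
Proof.
move=> sF; elim: s => [|i s IH].
  by under eq_fun do rewrite big_nil; exact: smooth_at_cst.
by under eq_fun do rewrite big_cons; exact: smooth_atD.
Qed.

Lemma smooth_at_prod I (s : seq I) A (F : I -> P -> R) :
  (forall i, smooth_at c A x (F i)) ->
  smooth_at c A x (fun y => \prod_(i <- s) F i y).
Proof.
move=> sF; elim: s => [|i s IH].
  by under eq_fun do rewrite big_nil; exact: smooth_at_cst.
by under eq_fun do rewrite big_cons; exact: smooth_atM.
Qed.

Lemma smooth_at_det k A (B : P -> 'M[R]_k) :
  (forall i j, smooth_at c A x (fun y => B y i j)) ->
  smooth_at c A x (fun y => \det (B y)).
Proof.
move=> sB; apply: smooth_at_sum => s; apply: smooth_atM.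
  exact: smooth_at_cst.
exact: smooth_at_prod.
Qed.

Lemma smooth_at_mulmx k l m A (B : P -> 'M[R]_(k, l)) (C : P -> 'M[R]_(l, m)) :
  (forall i j, smooth_at c A x (fun y => B y i j)) ->
  (forall i j, smooth_at c A x (fun y => C y i j)) ->
  forall i j, smooth_at c A x (fun y => (B y *m C y) i j).
Proof.
move=> sB sC i j; under eq_fun do rewrite mxE.
by apply: smooth_at_sum => l'; exact: smooth_atM.
Qed.

Lemma smooth_at_adj k A (B : P -> 'M[R]_k) :
  (forall i j, smooth_at c A x (fun y => B y i j)) ->
  forall i j, smooth_at c A x (fun y => (\adj (B y)) i j).
Proof.
move=> sB i j; under eq_fun do rewrite mxE.
apply: smooth_atM; first exact: smooth_at_cst.
by apply: smooth_at_det => i' j'; under eq_fun do rewrite !mxE.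
Qed.

(** Near [x] the function [f] is the quotient of [h] by [g].  Stating this by
    [f * g = h] on all of [A] spares a discussion of where [g] vanishes. *)
Lemma smooth_at_quot A f g h : A x ->
  smooth_at c A x g -> smooth_at c A x h -> g x != 0 ->
  (forall y, A y -> f y * g y = h y) -> smooth_at c A x f.
Proof.
move=> Ax [ O [u [oO Ox Oc Cu gu]]] [ O' [v [oO' Ox' Oc' Cv hv]]] gx fgh.
have oI : open (O `&` O') by exact: openI.
pose W := (O `&` O') `&` [set w | u w != 0].
have oW : open W.
  rewrite openE => w [[Ow Ow'] uw]; rewrite /interior /W.
  apply: filterI; first exact: open_nbhs_nbhs.
  have nz : nbhs (u w) [set r | r != 0].
    by apply: open_nbhs_nbhs; split=> //; exact: open_neq.
  by apply: (Cu 0%N w Ow) nz.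
exists W, (fun w => v w * (u w)^-1); split=> //.
- by split=> //=; rewrite -gu.
- by move=> w [[/Oc]].
- move=> k; apply: CkM => //; first by apply: Ck_sub (Cv k) => w [[]].
  apply: CkV => //; first by move=> w [].
  by apply: Ck_sub (Cu k) => w [[]].
move=> y Ay cy [[Oy Oy'] /= uy].
by rewrite -hv // -fgh // gu // mulfK.
Qed.

(** The coefficients of a smooth row in a smooth frame are smooth, by Cramer's
    rule.  The frame need not be square; multiplying it on the right by a
    constant right inverse [K] of its value at [x] makes it square, and equal to
    the identity at [x].  The resulting identity holds on all of [A], also where
    the determinant vanishes. *)
Lemma smooth_at_coefs k l A (w : P -> 'rV[R]_l) (Th : P -> 'M[R]_(k, l))
    (lam : P -> 'rV[R]_k) : A x -> row_free (Th x) ->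
  (forall j, smooth_at c A x (fun y => w y 0 j)) ->
  (forall i j, smooth_at c A x (fun y => Th y i j)) ->
  (forall y, A y -> w y = lam y *m Th y) ->
  forall a, smooth_at c A x (fun y => lam y 0 a).
Proof.
move=> Ax fTh sw sTh wE a; pose K := pinvmx (Th x).
have sK i j : smooth_at c A x (fun=> K i j) by exact: smooth_at_cst.
have sTK := smooth_at_mulmx sTh sK.
apply: (smooth_at_quot (g := fun y => \det (Th y *m K))
   (h := fun y => (w y *m K *m \adj (Th y *m K)) 0 a)) => //.
- exact: smooth_at_det.
- apply: (smooth_at_mulmx (B := fun y => w y *m K)
    (C := fun y => \adj (Th y *m K))); last exact: smooth_at_adj.
  by apply: (smooth_at_mulmx (B := w) (C := fun=> K)) => // i; rewrite ord1.
- by rewrite mulmxVp // det1 oner_neq0.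
move=> y Ay; rewrite wE // -(mulmxA (lam y)) -mulmxA mul_mx_adj.
by rewrite mul_mx_scalar mxE mulrC.
Qed.

Lemma partial_local f (g : 'rV[R]_N -> R) (O : set 'rV[R]_N) i :
  open O -> O (cmap c x) -> O `<=` cmap c @` cdom c ->
  (forall y, cdom c y -> O (cmap c y) -> f y = g (cmap c y)) ->
  partial c i f x = 'D_(delta_mx 0 i) g (cmap c x).
Proof.
move=> oO Ox Oc fg; apply: near_eq_derive; apply: (open_near_eq oO Ox) => u Ou.
by have [y cy yu] := Oc u Ou; rewrite -yu cmapK // fg // yu.
Qed.

End InChart.

(** The hypothesis is smoothness on the whole manifold, not on [A]: partial
    derivatives are determined by a local extension only if it agrees with the
    function on an open set. *)
Lemma smooth_at_partial c x A f i : chart_around x c -> smooth_on setT f ->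
  smooth_at c A x (partial c i f).
Proof.
move=> xc /smooth_on_at-/(_ c x I xc) [ O [g [oO Ox Oc Cg fg]]].
exists O, (fun u => 'D_(delta_mx 0 i) g u); split=> //.
  exact: Cinfty_derive.
move=> y Ay cy Oy; apply: (partial_local i oO Oy Oc) => z cz Oz.
exact: fg.
Qed.

End SmoothGerms.

(** * Contact geometry in a Darboux chart *)

Section DarbouxIndices.
Variables (R : realType) (n : nat).

Lemma darboux_ind (Q : 'I_(n + n + 1) -> Prop) :
  (forall i, Q (iq i)) -> (forall i, Q (ip i)) -> Q (iz n) -> forall j, Q j.
Proof.
move=> Qq Qp Qz j; case: (split_ordP j) => l ->; last by rewrite ord1.
by case: (split_ordP l) => i ->; [exact: Qq|exact: Qp].
Qed.

Lemma darboux_sum (F : 'I_(n + n + 1) -> R) :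
  \sum_j F j = \sum_i F (iq i) + \sum_i F (ip i) + F (iz n).
Proof. by rewrite !big_split_ord big_ord1. Qed.

Variables (a b : 'I_n -> R) (m : R).

Lemma covec_q i : covec a b m 0 (iq i) = a i.
Proof. by rewrite /covec !row_mxEl mxE. Qed.

Lemma covec_p i : covec a b m 0 (ip i) = b i.
Proof. by rewrite /covec row_mxEl row_mxEr mxE. Qed.

Lemma covec_z : covec a b m 0 (iz n) = m.
Proof. by rewrite /covec row_mxEr mxE. Qed.

Lemma eq_ip (i j : 'I_n) : (ip i == ip j) = (i == j).
Proof. by apply/eqP/eqP => [/lshift_inj/rshift_inj|->]. Qed.

Lemma iq_neq_ip (i j : 'I_n) : (iq i == ip j) = false.
Proof.
by apply/negP => /eqP/lshift_inj/eqP; rewrite eq_lrshift.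
Qed.

Lemma iz_neq_ip (j : 'I_n) : (iz n == ip j) = false.
Proof. by rewrite /iz /ip eq_rlshift. Qed.

Lemma pairingE (u v : 'rV[R]_(n + n + 1)) :
  pairing u v = \sum_j u 0 j * v 0 j.
Proof. by rewrite /pairing mxE; apply: eq_bigr => j _; rewrite mxE. Qed.

End DarbouxIndices.

Section DarbouxChart.
Variables (R : realType) (n : nat) (P : manifold R (n + n + 1)).
Variables (eta : forall x : P, cotangent x) (c : chart R (n + n + 1) P).
Hypothesis darboux : Darboux_chart eta c.
Variables (x : P) (cx : cdom c x).
Implicit Types (v : 'rV[R]_(n + n + 1)).

Let around : chart_around x c. Proof. by case: darboux. Qed.

Lemma darboux_eta_q y i : cdom c y -> eta y c 0 (iq i) = - cmap c y 0 (ip i).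
Proof. by move=> cy; rewrite (darboux.2 _ cy) covec_q. Qed.

Lemma darboux_eta_p y i : cdom c y -> eta y c 0 (ip i) = 0.
Proof. by move=> cy; rewrite (darboux.2 _ cy) covec_p. Qed.

Lemma darboux_eta_z y : cdom c y -> eta y c 0 (iz n) = 1.
Proof. by move=> cy; rewrite (darboux.2 _ cy) covec_z. Qed.

Lemma partial_cst (f : P -> R) a j : (forall y, cdom c y -> f y = a) ->
  partial c j f x = 0.
Proof.
move=> fa; rewrite (partial_local (g := cst a) (O := cmap c @` cdom c)) //.
- exact: derive_cst.
- exact: ccod_open.
- by move=> y cy _; exact: fa.
Qed.

Lemma partial_eta_q i j :
  partial c j (fun y => eta y c 0 (iq i)) x = - (j == ip i)%:R.
Proof.
rewrite (partial_local (g := fun u => - u 0 (ip i)) (O := cmap c @` cdom c)) //.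
- rewrite deriveN; last exact/diff_derivable/differentiable_coord.
  by rewrite derive_coord mxE eqxx eq_sym.
- exact: ccod_open.
- by move=> y cy _; exact: darboux_eta_q.
Qed.

Lemma partial_eta_p i j : partial c j (fun y => eta y c 0 (ip i)) x = 0.
Proof. by apply: partial_cst => y; exact: darboux_eta_p. Qed.

Lemma partial_eta_z j : partial c j (fun y => eta y c 0 (iz n)) x = 0.
Proof. by apply: partial_cst => y; exact: darboux_eta_z. Qed.

Definition partial_eta := (partial_eta_q, partial_eta_p, partial_eta_z).

(** Since d eta = dq^i /\ dp_i, contraction exchanges the q- and p-components
    up to sign and kills the z-component. *)
Lemma contract_deta_q v i : (v *m ext_deriv c eta x) 0 (iq i) = - v 0 (ip i).
Proof.
rewrite mxE darboux_sum !mxE !partial_eta iz_neq_ip.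
rewrite big1 ?add0r => [|j _]; last first.
  by rewrite mxE !partial_eta !iq_neq_ip subrr mulr0.
rewrite subr0 oppr0 mulr0 addr0 (bigD1 i) //= big1 => [|j ji].
  by rewrite mxE !partial_eta eqxx subr0 mulrN1 addr0.
by rewrite mxE !partial_eta eq_ip (negbTE ji) subr0 oppr0 mulr0.
Qed.

Lemma contract_deta_p v i : (v *m ext_deriv c eta x) 0 (ip i) = v 0 (iq i).
Proof.
rewrite mxE darboux_sum !mxE !partial_eta subrr mulr0 addr0.
rewrite [X in _ + X]big1 ?addr0 => [|j _]; last first.
  by rewrite mxE !partial_eta subrr mulr0.
rewrite (bigD1 i) //= big1 => [|j ji].
  by rewrite mxE !partial_eta eqxx sub0r opprK mulr1 addr0.
by rewrite mxE !partial_eta eq_ip eq_sym (negbTE ji) oppr0 subrr mulr0.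
Qed.

Lemma contract_deta_z v : (v *m ext_deriv c eta x) 0 (iz n) = 0.
Proof.
rewrite mxE big1 // => j _; rewrite mxE partial_eta.
elim/darboux_ind: j => [i|i|]; rewrite !partial_eta ?subrr ?mulr0 //.
by rewrite iz_neq_ip oppr0 subrr mulr0.
Qed.

Lemma pairing_eta v : pairing (eta x c) v =
  v 0 (iz n) - \sum_i cmap c x 0 (ip i) * v 0 (iq i).
Proof.
rewrite pairingE darboux_sum darboux_eta_z // mul1r addrC; congr (_ + _).
rewrite [X in _ + X]big1 => [|i _]; last by rewrite darboux_eta_p ?mul0r.
by rewrite addr0 -sumrN; apply: eq_bigr => i _; rewrite darboux_eta_q ?mulNr.
Qed.

Variable Rb : forall x : P, tangent x.
Hypothesis reeb : Reeb_field eta Rb.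

(** The q- and p-components vanish because the Reeb field is in the kernel of
    d eta; normalization by eta then fixes the z-component. *)
Lemma Reeb_darboux : Rb x c = delta_mx 0 (iz n).
Proof.
have [Rdeta Reta] := reeb.2 x c around.
have Rp i : Rb x c 0 (ip i) = 0.
  by apply/eqP; rewrite -oppr_eq0 -contract_deta_q Rdeta mxE.
have Rq i : Rb x c 0 (iq i) = 0 by rewrite -contract_deta_p Rdeta mxE.
apply/rowP; elim/darboux_ind => [i|i|]; rewrite mxE.
- by rewrite Rq (eq_sym (iq i)) eq_rlshift andbF.
- by rewrite Rp (eq_sym (ip i)) iz_neq_ip andbF.
move: Reta; rewrite pairing_eta big1 ?subr0 => [->|i _]; first by rewrite !eqxx.
by rewrite Rq mulr0.
Qed.

Lemma pairing_Reeb (H : P -> R) :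
  pairing (differential c H x) (Rb x c) = partial c (iz n) H x.
Proof.
rewrite Reeb_darboux pairingE (bigD1 (iz n)) //= big1 => [|j /negbTE jz].
  by rewrite !mxE !eqxx mulr1 addr0.
by rewrite !mxE jz andbF mulr0.
Qed.

Variables (X : forall x : P, tangent x) (H : P -> R).

(** The covector flat(X) - dH + (H + R(H)) eta, zero exactly when [X]
    obeys the unconstrained contact Hamilton equations; along a constrained
    motion it is the reaction covector. *)
Definition hamiltonian_defect y : 'rV[R]_(n + n + 1) :=
  flat eta c (X y) - differential c H y +
  (H y + pairing (differential c H y) (Rb y c)) *: eta y c.

Let p i := cmap c x 0 (ip i).
Let etaX := X x c 0 (iz n) - \sum_i p i * X x c 0 (iq i).

Lemma hamiltonian_defect_q i : hamiltonian_defect x 0 (iq i) =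
  - X x c 0 (ip i) - p i * etaX - partial c (iq i) H x
  - p i * (H x + partial c (iz n) H x).
Proof.
rewrite /hamiltonian_defect /flat pairing_Reeb pairing_eta.
move: (contract_deta_q (X x c) i).
move: (X x c *m _) => B BE.
by rewrite !mxE BE darboux_eta_q // -/(p i) -/etaX; ring.
Qed.

Lemma hamiltonian_defect_p i :
  hamiltonian_defect x 0 (ip i) = X x c 0 (iq i) - partial c (ip i) H x.
Proof.
rewrite /hamiltonian_defect /flat pairing_Reeb pairing_eta.
move: (contract_deta_p (X x c) i).
move: (X x c *m _) => B BE.
by rewrite !mxE BE darboux_eta_p //; ring.
Qed.

Lemma hamiltonian_defect_z : hamiltonian_defect x 0 (iz n) = etaX + H x.
Proof.
rewrite /hamiltonian_defect /flat pairing_Reeb pairing_eta.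
move: (contract_deta_z (X x c)).
move: (X x c *m _) => B BE.
by rewrite !mxE BE darboux_eta_z // -/etaX; ring.
Qed.

End DarbouxChart.

(** * Frames of the annihilator and the multipliers *)

Section AnnihilatorFrame.
Variables (R : realType) (n k : nat) (P : manifold R (n + n + 1)).
Variables (A : set P) (F : forall x : P, set (tangent x)).
Variables (c : chart R (n + n + 1) P).
Variables (Phi Psi : 'I_k -> 'I_n -> P -> R) (mu : 'I_k -> P -> R).
Hypothesis frame : annihilator_frame A F c Phi Psi mu.

Definition frame_mx x : 'M[R]_(k, n + n + 1) :=
  \matrix_a covec (Phi a ^~ x) (Psi a ^~ x) (mu a x).

Lemma frame_mxE x a j :
  frame_mx x a j = covec (Phi a ^~ x) (Psi a ^~ x) (mu a x) 0 j.
Proof. by rewrite mxE. Qed.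

Lemma mul_frame_mx x (l : 'rV[R]_k) : l *m frame_mx x =
  \sum_a l 0 a *: covec (Phi a ^~ x) (Psi a ^~ x) (mu a x).
Proof. by rewrite mulmx_sum_row; apply: eq_bigr => a _; rewrite rowK. Qed.

Lemma frame_mx_free x : A x -> row_free (frame_mx x).
Proof.
have [_ _ fr] := frame; move=> /fr[_ indep _].
apply: inj_row_free => v; rewrite mul_frame_mx => /indep v0.
by apply/rowP => a; rewrite v0 mxE.
Qed.

Lemma annihilator_sub_frame x w : A x -> annihilator F x c w ->
  (w <= frame_mx x)%MS.
Proof.
have [_ _ fr] := frame; move=> /fr[_ _ gen] /gen[l ->].
apply/submxP; exists (\row_a l a); rewrite mul_frame_mx.
by apply: eq_bigr => a _; rewrite mxE.
Qed.

Lemma smooth_frame_mx x : A x -> chart_around x c ->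
  forall a j, smooth_at c A x (fun y => frame_mx y a j).
Proof.
have [sP sm _] := frame; move=> Ax xc a; have [_ cx] := xc.
elim/darboux_ind => [i|i|]; under eq_fun do rewrite frame_mxE.
- under eq_fun do rewrite covec_q; exact: (smooth_on_at (sP a i).1).
- under eq_fun do rewrite covec_p; exact: (smooth_on_at (sP a i).2).
- under eq_fun do rewrite covec_z; exact: (smooth_on_at (sm a)).
Qed.

End AnnihilatorFrame.

(** The explicit components show that the defect is built from coordinates, the
    components of [X], and [H] with its partial derivatives, all smooth. *)
Lemma smooth_hamiltonian_defect (R : realType) (n : nat)
    (P : manifold R (n + n + 1)) (eta : forall x : P, cotangent x)
    (Rb X : forall x : P, tangent x) (H : P -> R)
    (c : chart R (n + n + 1) P) (A : set P) x :
  Darboux_chart eta c -> Reeb_field eta Rb -> smooth_on setT H ->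
  smooth_vector_field setT X -> cdom c x ->
  forall j, smooth_at c A x (fun y => hamiltonian_defect eta c Rb X H y 0 j).
Proof.
move=> dc reeb sH sX cx; have xc : chart_around x c by case: dc.
have sXj j : smooth_at c A x (fun y => X y c 0 j).
  have Xj := smooth_on_at (sX c xc.1 j) (conj I cx) xc.
  have [ O [g [oO Ox Oc Cg fg]]] := Xj.
  by exists O, g; split=> // y _ cy; apply: fg.
have sHj j : smooth_at c A x (partial c j H) by exact: smooth_at_partial.
have sH0 : smooth_at c A x H.
  by apply: smooth_at_sub (smooth_on_at sH I xc).
have sp i : smooth_at c A x (fun y => cmap c y 0 i) by exact: smooth_at_cmap.
have sE : smooth_at c A x (fun y => X y c 0 (iz n)
    - \sum_i cmap c y 0 (ip i) * X y c 0 (iq i)).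
  by apply: smooth_atB => //; apply: smooth_at_sum => // i; exact: smooth_atM.
elim/darboux_ind => [i|i|].
- apply: (smooth_at_ext (f := fun y => - X y c 0 (ip i)
    - cmap c y 0 (ip i) * (X y c 0 (iz n)
       - \sum_j cmap c y 0 (ip j) * X y c 0 (iq j))
    - partial c (iq i) H y
    - cmap c y 0 (ip i) * (H y + partial c (iz n) H y))) => [y _ cy|].
    by rewrite hamiltonian_defect_q.
  do ?[apply: smooth_atB => //]; first exact: smooth_atN.
    exact: smooth_atM.
  by apply: smooth_atM => //; exact: smooth_atD.
- apply: (smooth_at_ext (f := fun y => X y c 0 (iq i) - partial c (ip i) H y))
      => [y _ cy|]; first by rewrite hamiltonian_defect_p.
  exact: smooth_atB.
apply: (smooth_at_ext (f := fun y => (X y c 0 (iz n)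
    - \sum_i cmap c y 0 (ip i) * X y c 0 (iq i)) + H y)) => [y _ cy|].
  by rewrite hamiltonian_defect_z.
exact: smooth_atD.
Qed.

Theorem theorem4 (R : realType) (n : nat) (P : manifold R (n + n + 1))
  (eta : forall x : P, cotangent x) (Rb : forall x : P, tangent x)
  (H : P -> R) (m : nat) (M : set P) (F : forall x : P, set (tangent x))
  (X : forall x : P, tangent x)
  (c : chart R (n + n + 1) P) (U : set P)
  (k : nat) (Phi Psi : 'I_k -> 'I_n -> P -> R) (mu : 'I_k -> P -> R)
  (r : nat) (phi : 'I_r -> P -> R) :
  contact_form n eta ->
  Reeb_field eta Rb ->
  smooth_on setT H ->
  embedded_submanifold m M ->
  subbundle M F ->
  smooth_vector_field setT X ->
  (forall x, M x -> forall d, chart_around x d ->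
     annihilator F x d
       (flat eta d (X x) - differential d H x
        + (H x + pairing (differential d H x) (Rb x d)) *: eta x d)) ->
  tangent_to m M X ->
  Darboux_chart eta c ->
  open U -> U `<=` cdom c ->
  annihilator_frame (M `&` U) F c Phi Psi mu ->
  (forall b, smooth_on U (phi b)) ->
  independent_on (M `&` U) phi ->
  (forall x, U x -> (M x <-> forall b, phi b x = 0)) ->
  exists lam : 'I_k -> P -> R,
    (forall a, smooth_on (M `&` U) (lam a)) /\
    forall (J : set R) (xi : R -> P),
      open J -> is_interval J -> integral_curve X J xi ->
      (forall t, J t -> M (xi t)) ->
      forall t, J t -> U (xi t) ->
      let q i s := cmap c (xi s) 0 (iq i) in
      let p i s := cmap c (xi s) 0 (ip i) in
      let z s := cmap c (xi s) 0 (iz n) in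
      let dH j := partial c j H (xi t) in
      [/\ forall i, is_derive t (1 : R) (q i)
            (dH (ip i) + \sum_a lam a (xi t) * Psi a i (xi t)),
          forall i, is_derive t (1 : R) (p i)
            (- dH (iq i) - p i t * dH (iz n)
             - \sum_a lam a (xi t) * (mu a (xi t) * p i t + Phi a i (xi t))),
          is_derive t (1 : R) z
            (\sum_i p i t * dH (ip i) - H (xi t)
             + \sum_a lam a (xi t)
                 * (mu a (xi t) + \sum_i p i t * Psi a i (xi t)))
        & forall b, phi b (xi t) = 0].
Proof.
move=> _ reeb sH _ _ sX ann _ dc oU Uc frame _ _ MU.
pose Th := frame_mx Phi Psi mu; pose w := hamiltonian_defect eta c Rb X H.
(* Where w is in the row space of Theta, this is the solution of
   w = lambda Theta; elsewhere its value is irrelevant. *)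
pose lam y := w y *m pinvmx (Th y).
have around y : U y -> chart_around y c.
  by move=> Uy; split; [exact: dc.1|exact: Uc].
have wE y : (M `&` U) y -> w y = lam y *m Th y.
  move=> MUy; rewrite mulmxKpV //; apply: (annihilator_sub_frame frame) => //.
  by apply: ann; [exact: MUy.1|exact/around/MUy.2].
exists (fun a y => lam y 0 a); split=> [a|J xi _ _ curve xiM t Jt Ut q p z dH].
  apply: smooth_at_on => x MUx; have xc := around _ MUx.2.
  exists c => //; apply: (smooth_at_coefs xc.2 (w := w) (Th := Th)) => //.
  - exact: (frame_mx_free frame).
  - by apply: smooth_hamiltonian_defect => //; exact: xc.2.
  - exact: (smooth_frame_mx frame).
have Mt := xiM t Jt; have cx := Uc _ Ut; have xc := around _ Ut.
have dxi i : is_derive t (1 : R) (fun s => cmap c (xi s) 0 i) (X (xi t) c 0 i).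
  by have [_ dcurve] := curve t Jt; exact: dcurve.
have wj j : w (xi t) 0 j = \sum_a lam (xi t) 0 a * Th (xi t) a j.
  by rewrite wE // mxE.
(* The components of w = lambda Theta along dq^i, dp_i and dz. *)
have wq i : w (xi t) 0 (iq i) = \sum_a lam (xi t) 0 a * Phi a i (xi t).
  by rewrite wj; apply: eq_bigr => a _; rewrite /Th frame_mxE covec_q.
have wp i : w (xi t) 0 (ip i) = \sum_a lam (xi t) 0 a * Psi a i (xi t).
  by rewrite wj; apply: eq_bigr => a _; rewrite /Th frame_mxE covec_p.
have wz : w (xi t) 0 (iz n) = \sum_a lam (xi t) 0 a * mu a (xi t).
  by rewrite wj; apply: eq_bigr => a _; rewrite /Th frame_mxE covec_z.
pose etaX := X (xi t) c 0 (iz n) - \sum_i p i t * X (xi t) c 0 (iq i).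
have Xq i : X (xi t) c 0 (iq i) =
    dH (ip i) + \sum_a lam (xi t) 0 a * Psi a i (xi t).
  by rewrite -wp /w hamiltonian_defect_p // -/(dH (ip i)); ring.
have etaXE : etaX = - H (xi t) + \sum_a lam (xi t) 0 a * mu a (xi t).
  by rewrite -wz /w hamiltonian_defect_z // -/etaX; ring.
split=> [i|i||b].
- by rewrite -Xq; exact: dxi.
- apply: is_derive_eq (dxi (ip i)) _.
  under eq_bigr do rewrite mulrDr mulrA.
  rewrite big_split -mulr_suml /=.
  rewrite -wq /w hamiltonian_defect_q // -/etaX etaXE.
  rewrite -/(p i t) -/(dH (iq i)) -/(dH (iz n)).
  by ring.
- apply: is_derive_eq (dxi (iz n)) _.
  have -> : X (xi t) c 0 (iz n) = etaX + \sum_i p i t * X (xi t) c 0 (iq i).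
    by rewrite subrK.
  have -> : \sum_i p i t * X (xi t) c 0 (iq i) = \sum_i p i t * dH (ip i) +
      \sum_a lam (xi t) 0 a * \sum_i p i t * Psi a i (xi t).
    under eq_bigr do rewrite Xq mulrDr mulr_sumr.
    rewrite big_split exchange_big /=; congr (_ + _).
    by apply: eq_bigr => a _; rewrite mulr_sumr; apply: eq_bigr => i _; ring.
  under [X in _ = _ + X]eq_bigr do rewrite mulrDr.
  by rewrite etaXE big_split /=; ring.
- exact: (MU _ Ut).1.
Qed.
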